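(* Let $S:\mathbb R^N\rightrightarrows\mathbb R^M$ be a set-valued mapping with closed graph, let $\bar v\in S(\bar x)$, and suppose $S$ is crypto-continuous at $\bar x$ for $\bar v$. Then the condition $$D_*S(\bar x\,|\,\bar v)(0)=\{0\}$$ is both necessary and sufficient for $S$ to have a single-valued localization at $\bar x$ for $\bar v$ that is Lipschitz continuous.
   Context: $\operatorname{gph}S=\{(x,v): v\in S(x)\}$. **Strict graphical derivative.** $D_*S(\bar x|\bar v):\mathbb R^N\rightrightarrows\mathbb R^M$ is defined by: $v'\in D_*S(\bar x|\bar v)(x')$ iff there are $t_k\searrow0$, $(x_k,v_k)\to(\bar x,\bar v)$ in $\operatorname{gph}S$ and $(x_k',v_k')\to(x',v')$ with $v_k+t_kv_k'\in S(x_k+t_kx_k')$. **Single-valued localization.** A single-valued localization of $S$ at $\bar x$ for $\bar v\in S(\bar x)$ is a single-valued mapping $s:\mathcal X\to\mathcal V$ with $s(\bar x)=\bar v$ and $\operatorname{gph}s=[\mathcal X\times\mathcal V]\cap\operatorname{gph}S$ for some neighborhood $\mathcal X\times\mathcal V$ of $(\bar x,\bar v)$. **Crypto-continuity.** $S:\mathbb R^N\rightrightarrows\mathbb R^M$ is crypto-continuous at $\bar x$ for $\bar v\in S(\bar x)$ if there is a neighborhood $\mathcal X\times\mathcal V$ of $(\bar x,\bar v)$ such that $C=[\mathcal X\times\mathcal V]\cap\operatorname{gph}S$ has a continuous parameterization $C=\{(x,v)=(f(w),g(w)): w\in W\}$ over an open set $W\subset\mathbb R^N$ such that the inverse from $(x,v)\in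 C$ to $w\in W$ is single-valued and continuous (so $C$ is homeomorphic to an open subset of $\mathbb R^N$, with $N$ the dimension of the domain space). *)

(* Defs.v *)
From mathcomp Require Import all_boot all_order all_algebra.
From mathcomp Require Import all_classical all_reals all_analysis.

Set Implicit Arguments.
Unset Strict Implicit.
Unset Printing Implicit Defensive.

Import Order.TTheory GRing.Theory Num.Theory.
Import numFieldNormedType.Exports.

Local Open Scope classical_set_scope.
Local Open Scope ring_scope.

(* R^n is 'rV[R]_n, normed by the sup norm; limits, neighborhoods and Lipschitz
   continuity do not depend on the choice of a norm. A set-valued mapping
   R^N =>> R^M is a function 'rV[R]_N -> set 'rV[R]_M. *)

Definition gph (X V : Type) (S : X -> set V) : set (X * V) :=
  [set p | S p.1 p.2].

Definition strict_graphical_derivative (R : realType) (N M : nat)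
    (S : 'rV[R]_N -> set 'rV[R]_M) (xbar : 'rV[R]_N) (vbar : 'rV[R]_M) :
    'rV[R]_N -> set 'rV[R]_M :=
  fun x' => [set v' |
    exists (t : nat -> R) (x dx : nat -> 'rV[R]_N) (v dv : nat -> 'rV[R]_M),
      [/\ (forall k, 0 < t k) /\ t @ \oo --> (0 : R),
          forall k, gph S (x k, v k),
          x @ \oo --> xbar /\ v @ \oo --> vbar,
          dx @ \oo --> x' /\ dv @ \oo --> v' &
          forall k, S (x k + t k *: dx k) (v k + t k *: dv k)]].

(* The mapping s : X -> V is represented by a total function of which only the
   values on X matter. *)
Definition single_valued_localization (R : realType) (N M : nat)
    (S : 'rV[R]_N -> set 'rV[R]_M) (xbar : 'rV[R]_N) (vbar : 'rV[R]_M)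
    (X : set 'rV[R]_N) (V : set 'rV[R]_M) (s : 'rV[R]_N -> 'rV[R]_M) : Prop :=
  [/\ nbhs xbar X, nbhs vbar V, set_fun X V s, s xbar = vbar &
      [set (x, s x) | x in X] = (X `*` V) `&` gph S].

(* w ranges over an open subset of 'rV[R]_N, with N the dimension of the domain
   space of S; h is the inverse of the parameterization, from C to W. *)
Definition crypto_continuous (R : realType) (N M : nat)
    (S : 'rV[R]_N -> set 'rV[R]_M) (xbar : 'rV[R]_N) (vbar : 'rV[R]_M) : Prop :=
  exists (X : set 'rV[R]_N) (V : set 'rV[R]_M),
    [/\ nbhs xbar X, nbhs vbar V &
      let C := (X `*` V) `&` gph S in
      exists (W : set 'rV[R]_N) (f : 'rV[R]_N -> 'rV[R]_N)
             (g : 'rV[R]_N -> 'rV[R]_M) (h : 'rV[R]_N * 'rV[R]_M -> 'rV[R]_N),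
        [/\ open W,
            {within W, continuous f} /\ {within W, continuous g},
            C = [set (f w, g w) | w in W],
            {within C, continuous h} &
            forall w, W w -> h (f w, g w) = w]].

(* Main.v *)
From HB Require Import structures.
Require Import Defs.
From mathcomp Require Import all_boot all_order all_fingroup all_algebra.
From mathcomp Require Import all_classical all_reals all_analysis.
From mathcomp Require Import ring lra zify.

Set Implicit Arguments.
Unset Strict Implicit.
Unset Printing Implicit Defensive.

Import Order.TTheory GRing.Theory Num.Theory.
Import numFieldNormedType.Exports.

Local Open Scope classical_set_scope.
Local Open Scope ring_scope.

(* If [D_* S(xbar|vbar)(0) = {0}], then by compactness of the unit ball no pairs
   of points of [gph S] near [(xbar, vbar)] have unbounded difference quotients,
   so [gph S] is locally the graph of a Lipschitz map over its projection. The
   parameterization of [gph S] then makes this projection the image of a ball of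
   R^N under a continuous injection, and invariance of domain shows that it is
   a neighborhood of [xbar].

   Invariance of domain for [f] on the unit cube B goes as follows. If a point
   [c] close to [f 0] is missed by [f], let [P] be a Lipschitz approximation of
   the inverse of [f]. A small translate [Q] of [P] has no zero on the sphere
   [|y - c| = eps], because a Lipschitz image of this (N-1)-dimensional set
   cannot fill a cube. Pushing [f B] radially out of the ball of radius [eps]
   around [c] before applying [Q] gives a map close to the identity of B
   without zeros, against the Poincare-Miranda theorem. The latter is the limit
   of a statement on labellings of a grid, which is Stokes' theorem for a cup
   product of coboundaries of the labels on the Kuhn triangulation. *)

(** * Labellings of a grid *)

Section KuhnChain.
Variables (n k : nat).
Implicit Types (q : {ffun 'I_n.+1 -> 'I_k}) (p : {perm 'I_n.+1}).
Implicit Types (v : nat -> {ffun 'I_n.+1 -> nat}) (i j a : 'I_n.+1).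
Implicit Types (s : 'I_n.+1 -> {ffun 'I_n.+1 -> nat} -> int).

(* [q] is the lowest corner of a unit cube; the simplex of the permutation [p]
   increments coordinate [i] between its vertices [p i] and [p i + 1]. *)
Definition kuhn_vertex q p (l : nat) : {ffun 'I_n.+1 -> nat} :=
  [ffun i => (q i + (p i < l))%N].

(* Value on the simplex [v] of the cup product of the coboundaries of the
   cochains [s i]. *)
Definition cup s v : int := \prod_i (s i (v i.+1) - s i (v i)).

(** The value of the cochain [c] on the fundamental chain of the cube of side [k]; the sign of [p]
    is the orientation of its simplex. *)
Definition kuhn_integral (c : (nat -> {ffun 'I_n.+1 -> nat}) -> int) : int :=
  \sum_(q : {ffun 'I_n.+1 -> 'I_k}) \sum_(p : 'S_n.+1)
    (-1) ^+ p * c (kuhn_vertex q p).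

Definition kuhn_sum s : int := kuhn_integral (cup s).

(* Exchanging the steps [m] and [m+1] of [p] only changes the vertex [m+1]. *)
Lemma alternating_sum_eq0 q (H : (nat -> {ffun 'I_n.+1 -> nat}) -> int) m :
    (m < n)%N ->
    (forall v w, (forall l, l != m.+1 -> v l = w l) -> H v = H w) ->
  \sum_(p : 'S_n.+1) (-1) ^+ p * H (kuhn_vertex q p) = 0.
Proof.
move=> mn Hext; set A := LHS; suff : A = - A by lia.
pose t := tperm (inord m : 'I_n.+1) (inord m.+1).
rewrite {1}/A (reindex_inj (mulIg t)) -sumrN; apply: eq_bigr => p _ /=.
have mval : (inord m : 'I_n.+1) = m :> nat by rewrite inordK; lia.
have m1val : (inord m.+1 : 'I_n.+1) = m.+1 :> nat by rewrite inordK; lia.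
have mm1 : (inord m : 'I_n.+1) != inord m.+1.
  by apply/eqP => /(congr1 val) /=; rewrite mval m1val; lia.
rewrite odd_permM odd_tperm mm1 addbT signrN mulNr; congr (- (_ * _)).
apply: Hext => l lm; apply/ffunP => i; rewrite !ffunE permM; congr (_ + _)%N.
by congr nat_of_bool; case: tpermP => [->|->|]; rewrite ?mval ?m1val //; lia.
Qed.

(* The factors of [cup] other than [i0] are moved, in order, to the edges other
   than [(m, m+1)], and [s i0] is evaluated at the vertex [t]. *)
Definition cup_skip s i0 (m t : nat) v : int :=
  (\prod_(i | i != i0)
    (s i (v (bump m (unbump i0 i)).+1) - s i (v (bump m (unbump i0 i)))))
  * s i0 (v t).

(** The two integrands differ in the edge of a single factor, [(m+1, m+2)] or [(m, m+1)]. Their sum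
    telescopes to a difference between the vertices [m+2] and [m], so the vertex [m+1] drops out. *)
Lemma cup_skip_step s i0 q m t : (m < n)%N -> t != m.+1 ->
  \sum_(p : 'S_n.+1) (-1) ^+ p * cup_skip s i0 m t (kuhn_vertex q p) =
  - \sum_(p : 'S_n.+1) (-1) ^+ p * cup_skip s i0 m.+1 t (kuhn_vertex q p).
Proof.
move=> mn tm; apply/eqP; rewrite -subr_eq0 opprK -big_split /=; apply/eqP.
under eq_bigr do rewrite -mulrDr.
apply: (alternating_sum_eq0 _ (H := fun v =>
  cup_skip s i0 m t v + cup_skip s i0 m.+1 t v) mn) => v w vw.
pose j := lift i0 (Ordinal mn).
have ji0 : j != i0 by rewrite eq_sym neq_lift.
have uj : unbump i0 j = m by rewrite /= bumpK.
have um i : i != i0 -> i != j -> unbump i0 i != m.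
  move=> ii0 ij; apply: contra ij => /eqP um; apply/eqP/val_inj => /=.
  by rewrite -um unbumpKcond; move: ii0; rewrite -val_eqE /=; case: eqP.
have E x : cup_skip s i0 m t x + cup_skip s i0 m.+1 t x =
    (\prod_(i | (i != i0) && (i != j))
      (s i (x (bump m (unbump i0 i)).+1) - s i (x (bump m (unbump i0 i)))))
    * (s j (x m.+2) - s j (x m)) * s i0 (x t).
  rewrite /cup_skip (bigD1 j) //= [X in _ + X * _](bigD1 j) //= !bumpK.
  have -> : bump m m = m.+1 by rewrite /bump leqnn.
  have -> : bump m.+1 m = m by rewrite /bump ltnn.
  rewrite [X in _ + _ * X * _](eq_bigr (fun i =>
    s i (x (bump m (unbump i0 i)).+1) - s i (x (bump m (unbump i0 i))))).
    by ring.
  move=> i /andP[ii0 ij]; have := um _ ii0 ij => h.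
  have -> // : bump m.+1 (unbump i0 i) = bump m (unbump i0 i).
  by rewrite /bump; lia.
rewrite !E (vw t) // (vw m.+2) 1?(vw m); [|lia|lia].
congr (_ * _ * _); apply: eq_bigr => i /andP[ii0 ij]; have := um _ ii0 ij => h.
by rewrite !vw // /bump; lia.
Qed.

Lemma cup_skip_shift s i0 q m t d : (m + d <= n)%N ->
    (forall l, (m < l <= m + d)%N -> t != l) ->
  \sum_(p : 'S_n.+1) (-1) ^+ p * cup_skip s i0 m t (kuhn_vertex q p) =
  (-1) ^+ d *
    \sum_(p : 'S_n.+1) (-1) ^+ p * cup_skip s i0 (m + d) t (kuhn_vertex q p).
Proof.
elim: d => [|d IHd] mdn tl; first by rewrite addn0 mul1r.
rewrite IHd; [|lia|by move=> l ?; apply: tl; lia].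
rewrite cup_skip_step; [|lia|by apply: tl; lia].
by rewrite addnS exprS mulN1r mulrN mulNr.
Qed.

Lemma cupE s i0 v :
  cup s v = cup_skip s i0 i0 i0.+1 v - cup_skip s i0 i0 i0 v.
Proof.
rewrite /cup (bigD1 i0) //= /cup_skip -mulrBr mulrC; congr (_ * _).
apply: eq_bigr => i ii0; rewrite unbumpKcond.
by move: ii0; rewrite -val_eqE /= => /negbTE ->.
Qed.

Definition face_constant s := forall i (x y : {ffun 'I_n.+1 -> nat}),
  (x i = 0 /\ y i = 0 \/ x i = k /\ y i = k)%N -> s i x = s i y.

(** Boundary terms vanish: if [a] is [i0] the factor [s i0] is 0, otherwise the factor of [a] is a
    difference of two values on the same face. *)
Lemma cup_skip_face s i0 a v c : face_constant s ->
    (forall x : {ffun 'I_n.+1 -> nat}, x i0 = 0%N \/ x i0 = k -> s i0 x = 0) ->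
    (c = 0 \/ c = k)%N -> (forall l, (l <= n)%N -> v l a = c) ->
  cup_skip s i0 n i0 v = 0.
Proof.
move=> sc s0 c0k va; rewrite /cup_skip.
have [ai0|ai0] := eqVneq a i0.
  by rewrite s0 ?mulr0 // -ai0 va // -ltnS.
rewrite (bigD1 a) //= (sc a _ (v (bump n (unbump i0 a)))) ?subrr ?mul0r //.
have h : (unbump i0 a < n)%N.
  have := ltn_ord a; have := ltn_ord i0; move: ai0; rewrite -val_eqE /= /unbump.
  by lia.
rewrite /bump leqNgt h add0n !va //; last by lia.
by case: c0k => ->; [left|right].
Qed.

(* Dropping the first vertex of a simplex and dropping the last vertex of its
   neighbour in direction [a] give the same face. *)
Lemma kuhn_rotate s i0 : face_constant s ->
    (forall x : {ffun 'I_n.+1 -> nat}, x i0 = 0%N \/ x i0 = k -> s i0 x = 0) ->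
  kuhn_integral (cup_skip s i0 0 i0.+1) =
  (-1) ^+ n * kuhn_integral (cup_skip s i0 n i0).
Proof.
move=> sc s0.
(* The cycle sending 0 to [n] and [l+1] to [l]: the coordinate that [p] increments first is
   incremented last by [p * r]. *)
pose r : {perm 'I_n.+1} := (lift_perm ord_max ord0 1)^-1%g.
have rodd : (r : bool) = odd n.
  by rewrite odd_permV odd_lift_perm odd_perm1 /= addbF addbF.
have r0 : r ord0 = ord_max.
  by rewrite -(lift_perm_id ord_max ord0 1%g) permK.
have rS l : r (lift ord0 l) = lift ord_max l.
  by rewrite -{1}[l]perm1 -(lift_perm_lift ord_max ord0 1%g) permK.
rewrite /kuhn_integral exchange_big [in RHS]exchange_big mulr_sumr.
rewrite [RHS](reindex_inj (mulIg r)); apply: eq_bigr => p _ /=.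
set a := (p^-1)%g ord0.
have pa : p a = ord0 by rewrite permKV.
(* The neighbouring cube is taken cyclically to make [h] injective; where it wraps around, both
   faces lie in the boundary and both terms vanish. *)
pose h q : {ffun 'I_n.+1 -> 'I_k} :=
  [ffun i => if i == a then ordS (q i) else q i].
have h_inj : injective h.
  move=> q q' /ffunP e; apply/ffunP => i; have := e i; rewrite !ffunE.
  by case: ifP => // _ /(can_inj (@ordSK _)).
rewrite mulr_sumr [RHS](reindex_inj h_inj); apply: eq_bigr => q _ /=.
have sg : (-1) ^+ n * (-1) ^+ (p * r)%g = (-1) ^+ p :> int.
  rewrite odd_permM rodd signr_addb signr_odd mulrCA -exprD addnn -mul2n exprM.
  by rewrite sqrrN !expr1n mulr1.
rewrite mulrA sg.
congr (_ * _).
have E v : cup_skip s i0 0 i0.+1 v = cup_skip s i0 n i0 (v \o S).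
  rewrite /cup_skip /=; congr (_ * _); apply: eq_bigr => i ii0.
  have b : bump n (unbump i0 i) = unbump i0 i.
    rewrite /bump leqNgt.
    have := ltn_ord i; have := ltn_ord i0; move: ii0.
    by rewrite -val_eqE /= /unbump; lia.
  by rewrite b /bump leq0n add1n.
rewrite E.
have rp i (l : nat) : (l <= n)%N ->
    (r (p i) < l)%N = (i != a) && (p i < l.+1)%N.
  move=> ln; have [->|ia] := eqVneq i a; first by rewrite pa r0 /= ltnNge ln.
  case: (unliftP ord0 (p i)) => [b ->|pi0].
    by rewrite rS /= /bump leq0n; have := ltn_ord b; lia.
  by move: ia; rewrite -(inj_eq (@perm_inj _ p)) pa pi0 eqxx.
have [qa|qa] := eqVneq (q a).+1 k.
  rewrite (@cup_skip_face _ _ a _ k) //; [|by right|]; last first.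
    by move=> l ln; rewrite /= ffunE pa /= addn1.
  rewrite (@cup_skip_face _ _ a _ 0) //; [by left|] => l ln.
  by rewrite !ffunE eqxx /= permM rp // eqxx /= qa modnn.
have Ev l : (l <= n)%N ->
    kuhn_vertex q p l.+1 = kuhn_vertex (h q) (p * r) l.
  move=> ln; apply/ffunP => i; rewrite !ffunE permM rp //.
  have [->|ia] := eqVneq i a; last by [].
  by rewrite pa /= modn_small ?addn0 ?addn1 //; have := ltn_ord (q a); lia.
rewrite /cup_skip /= Ev; last by rewrite -ltnS.
congr (_ * _); apply: eq_bigr => i ii0.
have b : ((bump n (unbump i0 i)).+1 <= n)%N.
  rewrite /bump.
  have := ltn_ord i; have := ltn_ord i0; move: ii0.
  by rewrite -val_eqE /= /unbump; lia.
by rewrite !Ev //; lia.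
Qed.

(** Stokes' theorem: [cupE] splits the coboundary of [s i0] into two end values. Shifting the free
    edge to the first place for one and to the last for the other leaves facets of adjacent
    simplices, which [kuhn_rotate] cancels. *)
Lemma kuhn_sum_eq0 s i0 : face_constant s ->
    (forall x : {ffun 'I_n.+1 -> nat}, x i0 = 0%N \/ x i0 = k -> s i0 x = 0) ->
  kuhn_sum s = 0.
Proof.
move=> sc s0.
have i0n : (i0 <= n)%N by rewrite -ltnS.
have E : kuhn_sum s =
    (-1) ^+ i0 * kuhn_integral (cup_skip s i0 0 i0.+1) -
    (-1) ^+ (n - i0) * kuhn_integral (cup_skip s i0 n i0).
  rewrite /kuhn_sum /kuhn_integral !mulr_sumr -sumrB; apply: eq_bigr => q _.
  rewrite (@cup_skip_shift s i0 q 0 i0.+1 i0) ?add0n //; last by move=> l; lia.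
  rewrite mulrA -exprD addnn -mul2n exprM sqrrN !expr1n mul1r.
  have := @cup_skip_shift s i0 q i0 i0 (n - i0); rewrite subnKC // => <- //.
    by rewrite -sumrB; apply: eq_bigr => p _; rewrite -mulrBr -cupE.
  by move=> l; lia.
rewrite E kuhn_rotate // mulrA -exprD.
have -> : (i0 + n = i0.*2 + (n - i0))%N by lia.
by rewrite exprD -mul2n exprM sqrrN !expr1n mul1r subrr.
Qed.

Definition admissible s := forall i (x : {ffun 'I_n.+1 -> nat}),
  (x i = 0%N -> s i x = 0) /\ (x i = k -> s i x = k%:Z).

Lemma admissible_face_constant s : admissible s -> face_constant s.
Proof.
move=> sa i x y; have [x0 xk] := sa i x; have [y0 yk] := sa i y.
by move=> [[/x0-> /y0->]|[/xk-> /yk->]].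
Qed.

(** The members are exchanged one at a time. As [cup] is linear in each of them, an exchange costs
    the sum of a family with [s i0 - s' i0] in place [i0], and [kuhn_sum_eq0] applies. *)
Lemma kuhn_sum_indep s s' : admissible s -> admissible s' ->
  kuhn_sum s = kuhn_sum s'.
Proof.
move=> sa sa'; pose r (m : nat) i := if (i < m)%N then s' i else s i.
have rr m : (m <= n.+1)%N -> kuhn_sum s = kuhn_sum (r m).
  elim: m => [|m IHm] mn.
    by apply: eq_bigr => q _; apply: eq_bigr.
  rewrite IHm; last by lia.
  pose i0 := Ordinal mn.
  pose u i x := if i == i0 then s i0 x - s' i0 x else r m i x.
  apply/eqP; rewrite -subr_eq0 -(@kuhn_sum_eq0 u i0); first last.
  - move=> x; rewrite /u eqxx.
    have [h0 h1] := sa i0 x; have [h0' h1'] := sa' i0 x.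
    by case=> [z|z]; [rewrite h0 ?h0'|rewrite h1 ?h1'] => //; rewrite subrr.
  - move=> i x y h; rewrite /u /r.
    have e := admissible_face_constant sa h.
    have e' := admissible_face_constant sa' h.
    case: eqP => [ii0|_]; last by case: ifP.
    by rewrite -ii0 e e'.
  apply/eqP; rewrite /kuhn_sum /kuhn_integral -sumrB; apply: eq_bigr => q _.
  rewrite -sumrB; apply: eq_bigr => p _; rewrite -mulrBr; congr (_ * _).
  rewrite /cup (bigD1 i0) //= [X in _ - X](bigD1 i0) //= [RHS](bigD1 i0) //=.
  have rm : r m i0 = s i0 by rewrite /r /= ltnn.
  have rm1 : r m.+1 i0 = s' i0 by rewrite /r /= ltnSn.
  have ui0 x : u i0 x = s i0 x - s' i0 x by rewrite /u eqxx.
  rewrite rm rm1 !ui0.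
  set P1 := \prod_(i | _) _; set P2 := \prod_(i | _) _.
  set P3 := \prod_(i | _) _.
  have -> : P2 = P1.
    apply: eq_bigr => i ii0; rewrite /r ltnS leq_eqVlt.
    by move: ii0; rewrite -val_eqE /= => /negbTE ->.
  have -> : P3 = P1 by apply: eq_bigr => i /negbTE ii0; rewrite /u ii0.
  by ring.
rewrite (rr n.+1) //; apply: eq_bigr => q _; apply: eq_bigr => p _.
by congr (_ * _); apply: eq_bigr => i _; rewrite /r ltn_ord.
Qed.

(** It suffices to treat the coordinates themselves. The edge [i] of the simplex of [p] increments
    coordinate [i] only if [p i = i], so each cube contributes 1, through the identity. *)
Lemma kuhn_sum_admissible s : admissible s -> kuhn_sum s = (k ^ n.+1)%:Z.
Proof.
move=> sa; rewrite (@kuhn_sum_indep s (fun i x => (x i)%:Z)) //; last first.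
  by move=> i x; split=> ->.
rewrite /kuhn_sum /kuhn_integral (eq_bigr (fun=> 1)).
  by rewrite sumr_const card_ffun !card_ord natz.
move=> q _; rewrite (bigD1 1%g) //= odd_perm1 mul1r big1 ?addr0.
  rewrite /cup big1 // => i _; rewrite !ffunE perm1 ltnSn ltnn; lia.
move=> p p1; have [i pi] : exists i, p i != i.
  apply/existsP; apply: contraNT p1; rewrite negb_exists => /forallP h.
  by apply/eqP/permP => i; rewrite perm1; apply/eqP; have := h i; rewrite negbK.
rewrite /cup (bigD1 i) //= !ffunE ltnS leq_eqVlt.
by move: pi; rewrite -val_eqE /= => /negbTE ->; rewrite /= subrr mul0r mulr0.
Qed.

End KuhnChain.

(** Labels valued in 0 and [k] form an admissible family, so some simplex has a nonzero cup product:
    label [i] changes along its edge [i], for every [i]. *)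
Lemma cube_labelling n k (lab : 'I_n -> {ffun 'I_n -> nat} -> bool) :
    (0 < k)%N ->
    (forall i (x : {ffun 'I_n -> nat}), x i = 0%N -> lab i x = false) ->
    (forall i (x : {ffun 'I_n -> nat}), x i = k -> lab i x = true) ->
  exists q : {ffun 'I_n -> 'I_k}, forall i, exists x y : {ffun 'I_n -> nat},
    [/\ forall j, (q j <= x j <= (q j).+1)%N,
        forall j, (q j <= y j <= (q j).+1)%N, lab i x & ~~ lab i y].
Proof.
case: n lab => [|n] lab k0 lab0 lab1.
  by exists [ffun=> Ordinal k0] => -[].
pose s i x : int := if lab i x then k%:Z else 0.
have sa : admissible k s.
  by move=> i x; split=> [/lab0|/lab1]; rewrite /s => ->.
have : kuhn_sum k s != 0.
  by rewrite kuhn_sum_admissible // eqz_nat expn_eq0; lia.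
move=> /eqP nz.
have [q /existsP[p /forallP h]|no] := pickP (fun q : {ffun 'I_n.+1 -> 'I_k} =>
  [exists p : {perm 'I_n.+1}, [forall i : 'I_n.+1,
     lab i (kuhn_vertex q p i.+1) != lab i (kuhn_vertex q p i)]]).
  exists q => i; have := h i.
  have b l j : (q j <= kuhn_vertex q p l j <= (q j).+1)%N.
    by rewrite ffunE; case: ltnP => _; rewrite ?addn0 ?addn1 leqnn leqnSn.
  set x := kuhn_vertex q p i.+1; set y := kuhn_vertex q p i.
  case e : (lab i x); case e' : (lab i y) => // _.
    by exists x, y; split; rewrite ?e ?e' //; exact: b.
  by exists y, x; split; rewrite ?e ?e' //; exact: b.
case: nz; rewrite /kuhn_sum /kuhn_integral big1 // => q _.
rewrite big1 // => p _.
have /negbT := no q; rewrite negb_exists => /forallP /(_ p).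
rewrite negb_forall => /existsP[i]; rewrite negbK => /eqP e.
by rewrite /cup (bigD1 i) //= /s e subrr mul0r mulr0.
Qed.

(** * The Poincare-Miranda theorem *)

Section RowNorm.
Context {R : realType} {n : nat}.
Implicit Types v : 'rV[R]_n.

Lemma le_coord_norm v i : `|v ord0 i| <= `|v|.
Proof.
rewrite [leRHS]/Num.norm /= mx_normrE.
by apply/bigmax_geP; right; exists (ord0, i).
Qed.

Lemma row_norm_leP v (e : R) : 0 <= e ->
  reflect (forall i, `|v ord0 i| <= e) (`|v| <= e).
Proof.
move=> e0; apply: (iffP idP) => [ve i|ve].
  exact: le_trans (le_coord_norm v i) ve.
rewrite [leLHS]/Num.norm /= mx_normrE; apply/bigmax_leP; split=> // -[a i] _ /=.
by rewrite (ord1 a).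
Qed.

Lemma compact_unit_cube : compact [set v : 'rV[R]_n | `|v| <= 1].
Proof.
apply: bounded_closed_compact.
  exists 1; split=> // x x1 v /= v1; exact: le_trans v1 (ltW x1).
rewrite (_ : [set v : 'rV[R]_n | _] = Num.norm @^-1` [set x : R | x <= 1]) //.
apply: preimage_closed; last exact: closed_le.
by move=> v _; exact: norm_continuous.
Qed.

End RowNorm.

Lemma exists_norm_coord (R : realType) n (v : 'rV[R]_n.+1) :
  exists i, `|v| = `|v ord0 i|.
Proof.
have [v0|/mx_norm_neq0[[a i] /= h]] := eqVneq (mx_norm v) 0.
  have -> : v = 0 by exact: mx_norm_eq0.
  by exists ord0; rewrite mxE !normr0.
by exists i; move: h; rewrite (ord1 a).
Qed.

Lemma miranda_approx (R : realType) n (F : 'rV[R]_n -> 'rV[R]_n) (k : nat) :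
    (0 < k)%N ->
    (forall (b : 'rV[R]_n) i, `|b| <= 1 -> b ord0 i = -1 -> F b ord0 i < 0) ->
    (forall (b : 'rV[R]_n) i, `|b| <= 1 -> b ord0 i = 1 -> 0 < F b ord0 i) ->
  exists2 p : 'rV[R]_n, `|p| <= 1 & forall i, exists b b' : 'rV[R]_n,
    [/\ `|p - b| <= 2 / k%:R, `|p - b'| <= 2 / k%:R,
      (`|b| <= 1) /\ (`|b'| <= 1), 0 < F b ord0 i & F b' ord0 i <= 0].
Proof.
move=> k0 Fneg Fpos.
have k0' : 0 < k%:R :> R by rewrite ltr0n.
(* A grid of step [2 / k]; the minimum with [k] keeps indices beyond the grid inside the cube. *)
pose pt (x : {ffun 'I_n -> nat}) : 'rV[R]_n :=
  \row_j (-1 + 2 * (minn (x j) k)%:R / k%:R).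
have ptB x : `|pt x| <= 1.
  apply/row_norm_leP => // i; rewrite mxE ler_norml.
  have h0 : 0 <= (minn (x i) k)%:R / k%:R :> R by rewrite divr_ge0.
  have h1 : (minn (x i) k)%:R / k%:R <= 1 :> R.
    by rewrite ler_pdivrMr // mul1r ler_nat geq_minr.
  by lra.
pose lab i x := 0 < F (pt x) ord0 i.
have lab0 i (x : {ffun 'I_n -> nat}) : x i = 0%N -> lab i x = false.
  move=> xi; apply/negbTE; rewrite /lab -leNgt; apply/ltW/Fneg => //.
  by rewrite mxE xi min0n mulr0 mul0r addr0.
have lab1 i (x : {ffun 'I_n -> nat}) : x i = k -> lab i x = true.
  move=> xi; apply: Fpos => //.
  by rewrite mxE xi minnn mulfK ?gt_eqF //; lra.
have [q hq] := cube_labelling k0 lab0 lab1.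
pose q' : {ffun 'I_n -> nat} := [ffun i => q i : nat].
exists (pt q') => // i.
have [x [y [xq yq lx ly]]] := hq i.
have close (z : {ffun 'I_n -> nat}) :
    (forall j, (q j <= z j <= (q j).+1)%N) -> `|pt q' - pt z| <= 2 / k%:R.
  move=> zq; apply/row_norm_leP => [|j]; first by rewrite divr_ge0 // ler0n.
  rewrite !mxE ffunE.
  have [m [-> m1]] : exists m,
      minn (z j) k = (minn (q j) k + m)%N /\ (m <= 1)%N.
    have /andP[h1 h2] := zq j; have := ltn_ord (q j) => h3.
    by exists (minn (z j) k - minn (q j) k)%N; lia.
  have m1' : m%:R <= 1 :> R by rewrite lern1.
  have m0' : 0 <= m%:R :> R by [].
  rewrite (_ : _ - _ = - (2 * m%:R / k%:R)); last by rewrite natrD; ring.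
  rewrite normrN ger0_norm ?divr_ge0 ?mulr_ge0 // ler_pM2r ?invr_gt0 //.
  by lra.
exists (pt x), (pt y); split=> //; [exact: close|exact: close|].
by rewrite leNgt.
Qed.

(** Approximate zeros on finer and finer grids cluster at some [b]. A nonzero coordinate of [F b]
    would keep its sign near [b], where [miranda_approx] gives both a positive and a nonpositive
    value. *)
Lemma poincare_miranda (R : realType) n (F : 'rV[R]_n -> 'rV[R]_n) :
    (forall b : 'rV[R]_n, `|b| <= 1 -> {for b, continuous F}) ->
    (forall (b : 'rV[R]_n) i, `|b| <= 1 -> b ord0 i = -1 -> F b ord0 i < 0) ->
    (forall (b : 'rV[R]_n) i, `|b| <= 1 -> b ord0 i = 1 -> 0 < F b ord0 i) ->
  exists2 b : 'rV[R]_n, `|b| <= 1 & F b = 0.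
Proof.
move=> Fc Fneg Fpos.
have /choice[p hp] : forall k, exists p : 'rV[R]_n, `|p| <= 1 /\
    forall i, exists b b' : 'rV[R]_n,
    [/\ `|p - b| <= 2 / k.+1%:R, `|p - b'| <= 2 / k.+1%:R,
      (`|b| <= 1) /\ (`|b'| <= 1), 0 < F b ord0 i & F b' ord0 i <= 0].
  move=> k; have [p p1 hp] := @miranda_approx R n F k.+1 isT Fneg Fpos.
  by exists p.
have [b [/= b1 bcl]] :
    [set v : 'rV[R]_n | `|v| <= 1] `&` cluster (p @ \oo) !=set0.
  apply: compact_unit_cube; exists 0%N => // k _ /=; exact: (hp k).1.
exists b => //; apply/rowP => i; rewrite mxE; apply: contrapT => /eqP Fi.
have e0 : 0 < `|F b ord0 i| by rewrite normr_gt0.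
have /nbhs_ballP[r /= r0 hr] : nbhs b [set y | `|F b - F y| < `|F b ord0 i|].
  have /cvgrPdist_lt := Fc b b1; exact.
have [K hK] : exists K : nat, 2 / K.+1%:R < r / 2.
  exists (Num.truncn (4 / r)); have := truncnS_gt (4 / r).
  by rewrite ltr_pdivrMr // ltr_pdivrMr ?ltr0n //; lra.
have [_ [[k /= Kk <-] pk]] :
    [set p k | k in [set k | (K <= k)%N]] `&` ball b (r / 2) !=set0.
  apply: bcl; last by apply: nbhsx_ballx; rewrite divr_gt0.
  by exists K => // k /= Kk; exists k.
have [x [y [px py _ Fx Fy]]] := (hp k).2 i.
have kK : 2 / k.+1%:R <= 2 / K.+1%:R :> R.
  by rewrite ler_pM2l // lef_pV2 ?posrE ?ltr0n // ler_nat.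
move: pk; rewrite -ball_normE /= => pk.
have near_b z : `|p k - z| <= 2 / k.+1%:R ->
    `|F b ord0 i - F z ord0 i| < `|F b ord0 i|.
  move=> pz; have /hr : ball b r z.
    have bz : b - z = (b - p k) + (p k - z) by rewrite subrKA.
    rewrite -ball_normE /= bz.
    apply: le_lt_trans (ler_normD _ _) _.
    by rewrite (splitr r) ltrD // (le_lt_trans pz) // (le_lt_trans kK).
  move=> /=; apply: le_lt_trans.
  by have := le_coord_norm (F b - F z) i; rewrite !mxE.
have := near_b _ px; have := near_b _ py; move: Fi e0 Fx Fy.
set a := F b ord0 i; set c := F x ord0 i; set d := F y ord0 i => a0 _ c0 d0.
have [ap|an|a00] := ltrgt0P a; last by rewrite a00 eqxx in a0.
- by rewrite !ltr_norml; lra.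
- by rewrite !ltr_norml; lra.
Qed.

(** * Invariance of domain *)

Section Envelope.
Context {R : realType} {T : Type} {V : normedModType R}.
Variables (D : set T) (f : T -> V) (phi : T -> R).
Hypotheses (D0 : D !=set0) (phi_lb : exists c, forall b, D b -> c <= phi b).
Implicit Types (L : R) (y : V).

(** McShane's inf-convolution: for injective [f] and [0 <= L], an [L]-Lipschitz function lying below
    [phi] composed with the inverse of [f] on the image of [D]. *)
Definition envelope L y : R := inf [set phi b + L * `|y - f b| | b in D].

Lemma envelope_ge L y (c : R) :
  (forall b, D b -> c <= phi b + L * `|y - f b|) -> c <= envelope L y.
Proof.
move=> h; apply: lb_le_inf; last by move=> _ [b Db <-]; exact: h.
by have [b Db] := D0; exists (phi b + L * `|y - f b|); exists b.
Qed.

Lemma envelope_le L y b : 0 <= L -> D b ->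
  envelope L y <= phi b + L * `|y - f b|.
Proof.
move=> L0 Db; apply: ge_inf; last by exists b.
have [c hc] := phi_lb; exists c => _ [b' Db' <-].
by rewrite -[c]addr0 lerD ?hc // mulr_ge0.
Qed.

Lemma envelope_lipschitz L y z : 0 <= L ->
  `|envelope L y - envelope L z| <= L * `|y - z|.
Proof.
move=> L0.
have h x x' : envelope L x - L * `|x - x'| <= envelope L x'.
  apply: envelope_ge => b Db; rewrite lerBlDr.
  apply: (le_trans (envelope_le x L0 Db)).
  by rewrite -addrA lerD2l -mulrDr ler_wpM2l // [leRHS]addrC ler_distD.
rewrite ler_norml; have := h y z; have := h z y; rewrite (distrC z y); lra.
Qed.

Lemma envelope_mono L L' y : 0 <= L -> L <= L' -> envelope L y <= envelope L' y.
Proof.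
move=> L0 LL'; apply: envelope_ge => b Db.
apply: (le_trans (envelope_le y L0 Db)).
by rewrite lerD2l ler_wpM2r.
Qed.

End Envelope.

(** Compactness makes injectivity quantitative: over the pairs at distance at least [eta], if any,
    [|f b - f b'|] has a positive minimum, and [L0] is the diameter 2 of the cube divided by it. *)
Lemma unit_cube_separation (R : realType) n (V : normedModType R)
    (f : 'rV[R]_n -> V) (eta : R) :
    0 < eta ->
    (forall b : 'rV[R]_n, `|b| <= 1 -> {for b, continuous f}) ->
    (forall b b' : 'rV[R]_n, `|b| <= 1 -> `|b'| <= 1 -> f b = f b' -> b = b') ->
  exists2 L0 : R, 0 <= L0 & forall L b b', L0 <= L -> `|b| <= 1 -> `|b'| <= 1 ->
    `|b - b'| <= eta + L * `|f b - f b'|.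
Proof.
move=> eta0 fc finj; pose B := [set b : 'rV[R]_n | `|b| <= 1].
pose K := (B `*` B) `&` [set p : 'rV[R]_n * 'rV[R]_n | eta <= `|p.1 - p.2| ].
have [K0|K0] := pselect (K !=set0); last first.
  exists 0 => // L b b' L0 Bb Bb'.
  have : ~~ (eta <= `|b - b'|) by apply/negP => h; apply: K0; exists (b, b').
  rewrite -ltNge => /ltW h; apply: (le_trans h).
  by rewrite lerDl mulr_ge0.
have Kc : compact K.
  apply: compact_closedI.
    by apply: compact_setX; exact: compact_unit_cube.
  rewrite (_ : mkset _ = (fun p : 'rV[R]_n * 'rV[R]_n => `|p.1 - p.2|) @^-1`
    [set x | eta <= x]) //.
  apply: preimage_closed; last exact: closed_ge.
  move=> p _; apply: cvg_norm; apply: cvgB; [exact: cvg_fst|exact: cvg_snd].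
have fK : {within K, continuous
    (fun p : 'rV[R]_n * 'rV[R]_n => `|f p.1 - f p.2|)}.
  apply: continuous_in_subspaceT => p /[!inE] -[[B1 B2] _].
  apply: cvg_norm; apply: cvgB.
    by apply: continuous_comp; [exact: cvg_fst|exact: fc].
  by apply: continuous_comp; [exact: cvg_snd|exact: fc].
have [p pK pmin] := compact_EVT_min K0 Kc fK.
move: pK; rewrite inE => -[[B1 B2] /= pe].
have mu0 : 0 < `|f p.1 - f p.2|.
  rewrite normr_gt0 subr_eq0; apply: contraTneq pe => /(finj _ _ B1 B2) ->.
  by rewrite subrr normr0 -ltNge.
exists (2 / `|f p.1 - f p.2|); first by rewrite divr_ge0.
move=> L b b'; rewrite ler_pdivrMr // => Ld Bb Bb'.
have L0 : 0 < L by rewrite -(pmulr_lgt0 _ mu0) (lt_le_trans _ Ld).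
have [h|/ltW h] := leP eta `|b - b'|; last first.
  by apply: (le_trans h); rewrite lerDl mulr_ge0 // ltW.
apply: (@le_trans _ _ (1 + 1)).
  exact: le_trans (ler_normB _ _) (lerD Bb Bb').
apply: (le_trans Ld); rewrite -[leLHS]add0r; apply: lerD; first exact: ltW.
by rewrite ler_pM2l //; apply: (pmin (b, b')); rewrite inE.
Qed.

Lemma avoid_on_sphere (R : realType) n (P : 'rV[R]_n.+1 -> 'rV[R]_n.+1)
    (c : 'rV[R]_n.+1) (eps eta L : R) :
    0 < eps -> 0 < eta -> 0 <= L ->
    (forall y z, `|P y - P z| <= L * `|y - z|) ->
  exists2 e : 'rV[R]_n.+1, `|e| <= eta &
    forall y, `|y - c| = eps -> P y + e != 0.
Proof.
move=> eps0 eta0 L0 PL; apply: contrapT => noe.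
have eps_ge0 := ltW eps0; have eta_ge0 := ltW eta0.
(* With this [m], the image by [P] of a cell of size [2 * eps / (m * K)] is smaller than the spacing
   [eta / K] of the translations. The choice of [K] makes [K^(n+1)] exceed the number of cells. *)
pose m := (Num.truncn (2 * eps * L / eta)).+1.
have hm : 2 * eps * L < eta * m%:R.
  by rewrite [ltRHS]mulrC -ltr_pdivrMr // truncnS_gt.
pose K := (2 * n.+1 * (2 * m) ^ n).+1.
have K0 : 0 < K%:R :> R by rewrite ltr0n.
have mK0 : 0 < (m * K)%:R :> R by rewrite ltr0n.
(* There are K^(n+1) translations [e a]. If each were useless, with a zero [y a]
   of [P + e a] on the sphere, then two of the [y a] would lie in the same cell
   among the 2(n+1)(mK+1)^n cells of the sphere, hence too close to each other
   for their images by [P]. *)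
pose e (a : {ffun 'I_n.+1 -> 'I_K}) : 'rV[R]_n.+1 :=
  \row_j ((a j)%:R * (eta / K%:R)).
have eK0 : 0 < eta / K%:R by rewrite divr_gt0.
have eK_ge0 := ltW eK0.
have /choice[y hy] : forall a, exists y, `|y - c| = eps /\ P y + e a = 0.
  move=> a; apply: contrapT => noy; apply: noe; exists (e a).
    apply/row_norm_leP => [|i]; first exact: ltW.
    rewrite mxE ger0_norm ?mulr_ge0 // mulrCA ger_pMr // ler_pdivrMr // mul1r.
    by rewrite ler_nat ltnW.
  by move=> y yc; apply/eqP => ye; apply: noy; exists y.
have /choice[i hi] : forall a, exists i, eps = `|(y a - c) ord0 i|.
  move=> a; have [i hi] := exists_norm_coord (y a - c).
  by exists i; rewrite -hi (hy a).1.
pose w a j : R := ((y a - c) ord0 j + eps) / (2 * eps) * (m * K)%:R.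
have ybd a j : `|(y a - c) ord0 j| <= eps by rewrite -(hy a).1 le_coord_norm.
have w0 a j : 0 <= w a j.
  rewrite /w mulr_ge0 // divr_ge0 ?mulr_ge0 //.
  by have := ybd a j; rewrite ler_norml => /andP[]; lra.
have wmK a j : (Num.truncn (w a j) < (m * K).+1)%N.
  rewrite ltnS -(ler_nat R); apply: (@le_trans _ _ (w a j)).
    by rewrite truncn_le.
  rewrite /w ger_pMl // ler_pdivrMr ?mulr_gt0 //.
  by have := ybd a j; rewrite ler_norml => /andP[]; lra.
(* In the sup norm, [i a] and the sign of that coordinate select a face of the sphere; the other
   coordinates, rounded, select a cell of it. *)
pose code a : ('I_n.+1 * bool) * {ffun 'I_n -> 'I_(m * K).+1} :=
  ((i a, 0 < (y a - c) ord0 (i a)), [ffun j => Ordinal (wmK a (lift (i a) j))]).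
have code_inj : injective code.
  move=> a b [iab sab /ffunP cab].
  have yab : `|y a - y b| <= 2 * eps / (m * K)%:R.
    apply/row_norm_leP => [|j]; first by rewrite divr_ge0 ?mulr_ge0 //.
    have -> : (y a - y b) ord0 j = (y a - c) ord0 j - (y b - c) ord0 j.
      by rewrite !mxE; ring.
    case: (unliftP (i a) j) => [l|] ->.
      have := congr1 val (cab l); rewrite !ffunE /= -iab => tt.
      have /andP[a1 a2] := truncn_itv (w0 a (lift (i a) l)).
      have /andP[b1 b2] := truncn_itv (w0 b (lift (i a) l)).
      have : `|w a (lift (i a) l) - w b (lift (i a) l)| <= 1.
        rewrite tt in a1 a2; rewrite ler_norml.
        by move: a1 a2 b1 b2; rewrite -natr1; lra.
      rewrite /w -mulrBl -mulrBl opprD addrACA subrr addr0 !normrM.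
      have -> : `|(2 * eps)^-1| = (2 * eps)^-1.
        by rewrite ger0_norm ?invr_ge0 ?mulr_ge0.
      rewrite (ger0_norm (ltW mK0)).
      by rewrite -ler_pdivlMr // ler_pdivrMr ?mulr_gt0 // mul1r mulrC.
    have ha := hi a; have hb := hi b; rewrite -iab in hb sab.
    rewrite (_ : (y a - c) ord0 (i a) = (y b - c) ord0 (i a)).
      by rewrite subrr normr0 divr_ge0 ?mulr_ge0 //.
    move: ha hb sab; set u := (y a - c) _ _; set v := (y b - c) _ _.
    case: (ltP 0 u) => u0; case: (ltP 0 v) => v0 //.
      by rewrite !gtr0_norm // => <- <-.
    by rewrite !ler0_norm // => -> /oppr_inj.
  have eab : `|e a - e b| < eta / K%:R.
    have eP x : e x = - P (y x) by apply/eqP; rewrite -addr_eq0 addrC (hy x).2.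
    rewrite !eP opprK addrC.
    apply: (le_lt_trans (PL _ _)); rewrite distrC.
    apply: (le_lt_trans (ler_wpM2l L0 yab)).
    rewrite natrM invfM; rewrite mulrA mulrA ltr_pM2r ?invr_gt0 //.
    by rewrite ltr_pdivrMr ?ltr0n //; rewrite mulrC.
  apply/ffunP => j; apply/val_inj.
  have := le_coord_norm (e a - e b) j => /le_lt_trans/(_ eab).
  rewrite !mxE -mulrBl normrM (gtr0_norm eK0) -ltr_pdivlMr // divff ?gt_eqF //.
  rewrite ltr_norml => /andP[h1 h2].
  case: (ltngtP (a j) (b j)) => // ab; exfalso; move: h1 h2.
    have : (val (a j) + 1)%N%:R <= (val (b j))%:R :> R by rewrite ler_nat addn1.
    by clear ab; rewrite natrD; lra.
  have : (val (b j) + 1)%N%:R <= (val (a j))%:R :> R by rewrite ler_nat addn1.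
  by clear ab; rewrite natrD; lra.
have := leq_card _ code_inj.
rewrite !card_prod !card_ffun !card_ord card_bool leqNgt => /negP; apply.
have h : ((m * K).+1 <= 2 * m * K)%N by lia.
apply: (@leq_ltn_trans (n.+1 * 2 * (2 * m * K) ^ n)).
  have hh d : ((m * K).+1 ^ d <= (2 * m * K) ^ d)%N.
    by case: d => // d; rewrite leq_exp2r.
  by apply: leq_mul.
rewrite expnMn mulnA expnS ltn_pmul2r ?expn_gt0 //.
by rewrite /K ltnS (mulnC n.+1).
Qed.

Section PushOut.
Context {R : realType} {V : normedModType R}.
Implicit Types (c y : V) (eps : R).

(** Points nearer to [c] than [eps], except [c], go radially to the sphere; the maximum with 1 fixes
    the farther ones. Division by 0 being 0, [c] stays in place. *)
Definition push_out c eps y : V := c + Num.max (eps / `|y - c|) 1 *: (y - c).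

Lemma push_out_far c eps y : 0 < eps -> eps <= `|y - c| -> push_out c eps y = y.
Proof.
move=> eps0 h; rewrite /push_out max_r ?scale1r ?subrKC //.
by rewrite ler_pdivrMr ?mul1r // (lt_le_trans eps0).
Qed.

Lemma push_out_near c eps y : y != c -> `|y - c| <= eps ->
  `|push_out c eps y - c| = eps.
Proof.
rewrite -subr_eq0 -normr_gt0 => yc h.
rewrite /push_out max_l; last by rewrite ler_pdivlMr ?mul1r.
rewrite addrC addKr normrZ ger0_norm ?divfK ?gt_eqF //.
by rewrite divr_ge0 // (le_trans _ h).
Qed.

Lemma push_out_continuous c eps y : y != c ->
  {for y, continuous (push_out c eps)}.
Proof.
move=> yc; apply: cvgD; first exact: cvg_cst.
apply: cvgZ; last by apply: cvgB; [exact: cvg_id|exact: cvg_cst].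
apply: (@continuous_max _ _ (fun y => eps / `|y - c|) (fun=> 1)).
  2: exact: cvg_cst.
apply: cvgM; first exact: cvg_cst.
apply: cvgV; first by rewrite normr_eq0 subr_eq0.
by apply: cvg_norm; apply: cvgB; [exact: cvg_id|exact: cvg_cst].
Qed.

End PushOut.

Lemma dist_min_le (R : realType) (a b c d k : R) :
  `|a - b| <= k -> `|c - d| <= k -> `|Num.min a c - Num.min b d| <= k.
Proof.
rewrite !ler_norml => /andP[? ?] /andP[? ?].
by case: (leP a c) => ?; case: (leP b d) => ?; lra.
Qed.

Lemma global_lipschitz_continuous (R : realType) (V W : normedModType R)
    (P : V -> W) (L : R) :
  0 <= L -> (forall y z, `|P y - P z| <= L * `|y - z|) -> continuous P.
Proof.
move=> L0 PL y; apply/cvgrPdist_lt => e e0.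
have L1 : 0 < L + 1 by rewrite ltr_wpDl.
apply/nbhs_ballP; exists (e / (L + 1)) => /=; first exact: divr_gt0.
move=> z; rewrite -ball_normE /= ltr_pdivlMr // => yz.
apply: le_lt_trans (PL y z) _; apply: le_lt_trans yz.
by rewrite mulrC ler_wpM2l // lerDl.
Qed.

Lemma unit_cube_image_nbhs (R : realType) n (f : 'rV[R]_n -> 'rV[R]_n) :
    (forall b : 'rV[R]_n, `|b| <= 1 -> {for b, continuous f}) ->
    (forall b b' : 'rV[R]_n, `|b| <= 1 -> `|b'| <= 1 -> f b = f b' -> b = b') ->
  nbhs (f 0) (f @` [set b | `|b| <= 1]).
Proof.
case: n f => [|n] f fc finj.
  rewrite (_ : _ @` _ = setT); first exact: filterT.
  apply/seteqP; split=> // y _; exists 0; last by apply/rowP => -[].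
  by rewrite /= normr0.
set B := [set b | _]; apply: contrapT => notN.
have B0 : B !=set0 by exists 0; rewrite /B /= normr0.
(* An error of [3 * eta] from [P] and one of [eta1 <= eta] from [e] add up to at most 1/2, so [F]
   has the required signs on the faces of the cube. *)
pose eta : R := 1 / 8; have eta0 : 0 < eta by rewrite /eta; lra.
have [L0 L0ge L0sep] := unit_cube_separation eta0 fc finj.
(* Pushing moves a point by at most [2 * eps], hence changes the envelopes of constant [L0] by at
   most [eta]. *)
pose eps := eta / (2 * (L0 + 1)).
have eps0 : 0 < eps by rewrite divr_gt0 //; lra.
have epsL0 : L0 * (2 * eps) <= eta.
  have -> : L0 * (2 * eps) = eta * (L0 / (L0 + 1)).
    by rewrite /eps; field; lra.
  by rewrite ger_pMr // ler_pdivrMr; lra.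
have [c cf0 cB] : exists2 c, `|f 0 - c| < eps & ~ (f @` B) c.
  apply: contrapT => no; apply: notN; apply/nbhs_ballP; exists eps => // c.
  rewrite -ball_normE /= => h; apply: contrapT => cB; apply: no; by exists c.
(* Since [f 0] is at distance less than [eps] from [c], so is [f b] for all [b] close to 0. *)
have [d d0 hd] : exists2 d : R, 0 < d &
    forall b, B b -> `|f b - c| < eps \/ d <= `|b|.
  have : nbhs (0 : 'rV[R]_n.+1) [set b | `|f 0 - f b| < eps - `|f 0 - c|].
    have fc0 : {for 0, continuous f} by apply: fc; rewrite normr0.
    by have /cvgrPdist_lt := fc0; apply; rewrite subr_gt0.
  move=> /nbhs_ballP[d /= d0 hd]; exists d => // b Bb.
  have [?|bd] := leP d `|b|; [by right|left].
  have /hd /= h : ball (0 : 'rV[R]_n.+1) d b.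
    by rewrite -ball_normE /= sub0r normrN.
  have -> : f b - c = (f b - f 0) + (f 0 - c) by rewrite subrKA.
  by apply: (le_lt_trans (ler_normD _ _)); rewrite distrC; lra.
(* A zero [b] of [F] with [f b] not pushed has norm at most [2 * eta1], which is then less than [d],
   against the choice of [d]. *)
have [eta1 [eta1_0 eta1_eta eta1_d]] :
    exists eta1, [/\ 0 < eta1, eta1 <= eta & 4 * eta1 <= d].
  exists (Num.min eta (d / 4)); split; rewrite ?ge_min ?lexx //.
    by rewrite lt_min eta0 divr_gt0.
  by rewrite mulrC -ler_pdivlMr // ge_min lexx orbT.
have [L1 L1ge L1sep] := unit_cube_separation eta1_0 fc finj.
pose L := L0 + L1.
have Lge : 0 <= L by rewrite addr_ge0.
have L0L : L0 <= L by rewrite lerDl.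
have L1L : L1 <= L by rewrite lerDr.
pose A i l := envelope B f (fun b : 'rV[R]_n.+1 => b ord0 i) l.
have lb (i : 'I_n.+1) :
    exists a : R, forall b : 'rV[R]_n.+1, B b -> a <= b ord0 i.
  exists (-1) => b Bb; have := le_trans (le_coord_norm b i) Bb.
  by rewrite ler_norml => /andP[].
have A_le i l b : 0 <= l -> B b -> A i l (f b) <= b ord0 i.
  move=> l0 Bb; have := envelope_le f (lb i) (f b) l0 Bb.
  by rewrite subrr normr0 mulr0 addr0.
have A_ge i l e b : (forall b', B b' -> `|b - b'| <= e + l * `|f b - f b'|) ->
    b ord0 i - e <= A i l (f b).
  move=> h; apply: envelope_ge => // b' Bb'.
  have := le_coord_norm (b - b') i => /le_trans/(_ (h _ Bb')).
  by rewrite !mxE ler_norml => /andP[_]; lra.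
(* The envelope with constant [L] approximates the inverse of [f] within [eta1]
   on [f @` B]; clipping it by the one with constant [L0] controls it within
   [3 eta] on the whole ball of radius [eps], although [eps] is chosen before
   [L]. *)
pose P y : 'rV[R]_n.+1 := \row_i Num.min (A i L y) (A i L0 y + eta).
have P_bounds i y : A i L0 y <= P y ord0 i <= A i L0 y + eta.
  rewrite mxE ge_min lexx orbT andbT le_min lerDl (ltW eta0) andbT.
  exact: envelope_mono.
have P_near b : B b -> `|P (f b) - b| <= eta1.
  move=> Bb; apply/row_norm_leP => [|i]; first exact: ltW.
  have h1 := @A_ge i L eta1 b (fun b' => @L1sep L b b' L1L Bb).
  have h2 := @A_ge i L0 eta b (fun b' => @L0sep L0 b b' (lexx _) Bb).
  have h3 := A_le i L b Lge Bb.
  rewrite !mxE min_l; last by lra.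
  by rewrite ler_norml; lra.
have P_lip y z : `|P y - P z| <= L * `|y - z|.
  apply/row_norm_leP => [|i]; first exact: mulr_ge0.
  rewrite !mxE; apply: dist_min_le; first exact: envelope_lipschitz.
  rewrite opprD addrACA subrr addr0.
  apply: (@le_trans _ _ (L0 * `|y - z|)); first exact: envelope_lipschitz.
  by rewrite ler_wpM2r.
have [e e1 hPe] := avoid_on_sphere c eps0 eta1_0 Lge P_lip.
pose F b := P (push_out c eps (f b)) + e.
have fbc b : B b -> f b != c by move=> Bb; apply/eqP => fb; apply: cB; exists b.
have [b b1 Fb0] : exists2 b : 'rV[R]_n.+1, `|b| <= 1 & F b = 0.
  have F_near b : B b -> `|F b - b| <= 1 / 2.
    move=> Bb; rewrite /F addrAC.
    apply: (le_trans (ler_normD _ _)).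
    suff : `|P (push_out c eps (f b)) - b| <= 3 * eta.
      by rewrite /eta in eta1_eta *; lra.
    have [far|/ltW fnear] := leP eps `|f b - c|.
      by rewrite push_out_far //; have := P_near _ Bb; lra.
    set y := push_out _ _ _.
    have yfb : `|y - f b| <= 2 * eps.
      rewrite (_ : y - f b = (y - c) + (c - f b)); last by rewrite subrKA.
      apply: (le_trans (ler_normD _ _)).
      by rewrite push_out_near ?fbc // distrC; lra.
    apply/row_norm_leP => [|i]; first by lra.
    have /andP[h1 h2] := P_bounds i y.
    have h3 := A_le i L0 b L0ge Bb.
    have h4 := @A_ge i L0 eta b (fun b' => @L0sep L0 b b' (lexx _) Bb).
    have h5 : `|A i L0 y - A i L0 (f b)| <= eta.
      apply: le_trans (envelope_lipschitz f B0 (lb i) _ _ L0ge) _.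
      by apply: le_trans epsL0; rewrite ler_wpM2l.
    have -> : (P y - b) ord0 i = P y ord0 i - b ord0 i by rewrite !mxE.
    by move: h5; rewrite !ler_norml; lra.
  have F_coord b i : B b -> `|F b ord0 i - b ord0 i| <= 1 / 2.
    move=> Bb; apply: le_trans (F_near _ Bb).
    by have := le_coord_norm (F b - b) i; rewrite !mxE.
  apply: poincare_miranda.
  - move=> b Bb.
    apply: (@continuousD _ _ _ (fun z => P (push_out c eps (f z))) (fun=> e)).
    2: exact: cst_continuous.
    apply: (@continuous_comp _ _ _ _ P).
      apply: continuous_comp; first exact: fc.
      by apply: push_out_continuous; exact: fbc.
    exact: (global_lipschitz_continuous Lge P_lip).
  - move=> b i Bb bi; have := F_coord b i Bb; rewrite bi ler_norml; lra.
  - move=> b i Bb bi; have := F_coord b i Bb; rewrite bi ler_norml; lra.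
have [far|/ltW fnear] := leP eps `|f b - c|; last first.
  by have := hPe _ (push_out_near (fbc b b1) fnear); rewrite -/(F b) Fb0 eqxx.
have [|db] := hd b b1; first by rewrite ltNge far.
move: Fb0; rewrite /F push_out_far // => Fb0.
have : `|b| <= eta1 + eta1.
  have -> : b = - ((P (f b) - b) + e) by rewrite addrAC Fb0 sub0r opprK.
  by rewrite normrN; apply: le_trans (ler_normD _ _) _; rewrite lerD // P_near.
by lra.
Qed.

(** * Strict graphical derivatives and localizations *)

Lemma cvg_dist_natSinv (R : realType) (V : normedModType R) (u : nat -> V)
    (l : V) (c : R) :
  (forall k, `|l - u k| <= c / k.+1%:R) -> u @ \oo --> l.
Proof.
move=> h; apply/cvgrPdist_lt => e e0; exists (Num.truncn (c / e)) => // k /= Nk.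
apply: le_lt_trans (h k) _; rewrite ltr_pdivrMr ?ltr0n // mulrC -ltr_pdivrMr //.
by apply: lt_le_trans (truncnS_gt _) _; rewrite ler_nat.
Qed.

(** Otherwise some pairs converging to the reference point have quotients above [k+1]. Rescaling by
    the distance [t] of their values gives unit vectors [dv] and vectors [dx] tending to 0, so a
    cluster point of [dv] is a nonzero element of the derivative at 0. *)
Lemma strict_derivative_lipschitz (R : realType) (N M : nat)
    (S : 'rV[R]_N -> set 'rV[R]_M) (xbar : 'rV[R]_N) (vbar : 'rV[R]_M) :
    (forall v', strict_graphical_derivative S xbar vbar 0 v' -> v' = 0) ->
  exists kappa r : R, 0 < r /\ forall x y v w,
    `|xbar - x| < r -> `|xbar - y| < r -> `|vbar - v| < r -> `|vbar - w| < r ->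
    S x v -> S y w -> `|v - w| <= kappa * `|x - y|.
Proof.
move=> D0; apply: contrapT => no.
have /choice[z hz] : forall k : nat,
    exists z : ('rV[R]_N * 'rV[R]_N) * ('rV[R]_M * 'rV[R]_M),
    [/\ [/\ `|xbar - z.1.1| < k.+1%:R^-1, `|xbar - z.1.2| < k.+1%:R^-1,
         `|vbar - z.2.1| < k.+1%:R^-1 & `|vbar - z.2.2| < k.+1%:R^-1],
       S z.1.1 z.2.1, S z.1.2 z.2.2 &
       k.+1%:R * `|z.1.1 - z.1.2| < `|z.2.1 - z.2.2| ].
  move=> k; apply: contrapT => noz; apply: no; exists k.+1%:R, k.+1%:R^-1.
  split=> [|x y v w hx hy hv hw Sxv Syw]; first by rewrite invr_gt0.
  by rewrite leNgt; apply/negP => h; apply: noz; exists ((x, y), (v, w)).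
pose t k := `|(z k).2.2 - (z k).2.1|.
have t0 k : 0 < t k.
  have [_ _ _] := hz k; rewrite /t (distrC (z k).2.2); apply: le_lt_trans.
  by rewrite mulr_ge0.
have tV k : 0 <= (t k)^-1 by rewrite invr_ge0 ltW.
pose dv k := (t k)^-1 *: ((z k).2.2 - (z k).2.1).
pose dx k := (t k)^-1 *: ((z k).1.2 - (z k).1.1).
have dv1 k : `|dv k| = 1 by rewrite normrZ ger0_norm // mulVf // gt_eqF.
have [v' [/= _ v'cl]] :
    [set v : 'rV[R]_M | `|v| <= 1] `&` cluster (dv @ \oo) !=set0.
  by apply: compact_unit_cube; exists 0%N => // k _ /=; rewrite dv1.
(* Along [sg], [dv] converges to [v']; [j <= sg j] carries the bounds in [1 / (k+1)] over to
   [1 / (j+1)]. *)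
have /choice[sg hsg] : forall j : nat,
    exists k, (j <= k)%N /\ `|v' - dv k| < j.+1%:R^-1.
  move=> j.
  have [_ [[k /= jk <-] h]] : [set dv k | k in [set k | (j <= k)%N]] `&`
      ball v' j.+1%:R^-1 !=set0.
    apply: v'cl; last by apply: nbhsx_ballx; rewrite invr_gt0.
    by exists j => // k /= jk; exists k.
  by exists k; split=> //; move: h; rewrite -ball_normE.
have inv_sg j : (sg j).+1%:R^-1 <= j.+1%:R^-1 :> R.
  by rewrite lef_pV2 ?posrE // ler_nat ltnS; case: (hsg j).
have v'0 : v' = 0; last first.
  have [_] := hsg 1%N; rewrite v'0 sub0r normrN dv1.
  by rewrite ltNge invf_le1 ?ler1n.
apply: D0; exists (t \o sg), (fun j => (z (sg j)).1.1), (dx \o sg),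
  (fun j => (z (sg j)).2.1), (dv \o sg); split.
- split=> [k|]; first exact: t0.
  apply: (@cvg_dist_natSinv _ _ _ _ 2) => j.
  rewrite sub0r normrN /= gtr0_norm //.
  have [[_ _ h1 h2] _ _ _] := hz (sg j); rewrite /t.
  have -> : (z (sg j)).2.2 - (z (sg j)).2.1 =
      (vbar - (z (sg j)).2.1) - (vbar - (z (sg j)).2.2).
    by rewrite opprB [RHS]addrC subrKA.
  apply: le_trans (ler_normB _ _) _.
  by rewrite (mulrDl 1 1) !mul1r lerD // (le_trans _ (inv_sg j)) // ltW.
- by move=> k; have [_ h _ _] := hz (sg k).
- by split; apply: (@cvg_dist_natSinv _ _ _ _ 1) => j; rewrite mul1r;
    apply: le_trans (inv_sg j); apply: ltW; have [[]] := hz (sg j).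
- split; apply: (@cvg_dist_natSinv _ _ _ _ 1) => j; rewrite mul1r; last first.
    by have [_ /ltW] := hsg j.
  rewrite sub0r normrN /= normrZ ger0_norm // mulrC ler_pdivrMr //.
  apply: le_trans (ler_wpM2r (ltW (t0 _)) (inv_sg j)).
  have [_ _ _ /ltW] := hz (sg j); rewrite distrC [X in _ <= X -> _]distrC => h.
  by rewrite mulrC ler_pdivlMr // mulrC.
- move=> k; have [_ _ h _] := hz (sg k).
  by rewrite /= !scalerA mulfV ?gt_eqF // !scale1r !subrKC.
Qed.

(** Dividing the Lipschitz estimate between [x + t dx] and [x] by [t] gives [|dv| <= k |dx|], where
    [dx] tends to 0 and [dv] to [v']. *)
Lemma localization_strict_derivative (R : realType) (N M : nat)
    (S : 'rV[R]_N -> set 'rV[R]_M) (xbar : 'rV[R]_N) (vbar : 'rV[R]_M)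
    (X : set 'rV[R]_N) (V : set 'rV[R]_M) (s : 'rV[R]_N -> 'rV[R]_M)
    (v' : 'rV[R]_M) :
    single_valued_localization S xbar vbar X V s -> [lipschitz s x | x in X] ->
  strict_graphical_derivative S xbar vbar 0 v' -> v' = 0.
Proof.
move=> [nX nV _ _ gphE] [M0 [_ lip]].
move=> [t [x [dx [v [dv [[t0 tcv] Sxv [xcv vcv] [dxcv dvcv] Syw]]]]]].
have sE y w : X y -> V w -> S y w -> w = s y.
  move=> Xy Vw Syw'.
  have : ((X `*` V) `&` gph S) (y, w) by [].
  by rewrite -gphE => -[y' _ [-> ->]].
(* The Lipschitz estimate holds for every constant above [M0]; this one is also positive. *)
pose k := `|M0| + 1.
have k0 : 0 < k by rewrite ltr_wpDl.
have kM : M0 < k by rewrite (le_lt_trans (ler_norm _)) // ltrDl.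
have {}lip y z : X y -> X z -> `|s y - s z| <= k * `|y - z|.
  by move=> Xy Xz; have := lip k kM (y, z); apply.
apply: contrapT => /eqP; rewrite -normr_gt0 => v'0.
have x2cv : (fun j => x j + t j *: dx j) @ \oo --> xbar.
  rewrite -[xbar]addr0 -(scale0r (0 : 'rV[R]_N)).
  by apply: cvgD => //; apply: cvgZ.
have v2cv : (fun j => v j + t j *: dv j) @ \oo --> vbar.
  by rewrite -[vbar]addr0 -(scale0r v'); apply: cvgD => //; apply: cvgZ.
have e0 : 0 < `|v'| / (2 * k) by rewrite divr_gt0 // mulr_gt0.
have dxs : \forall j \near \oo, `|dx j| < `|v'| / (2 * k).
  by apply: (cvgr_norm_lt 0 dxcv); rewrite normr0.
have dvs : \forall j \near \oo, `|dv j| > `|v'| / 2.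
  by apply: (cvgr_norm_gt v' dvcv); lra.
have xX : \forall j \near \oo, X (x j) := xcv _ nX.
have vV : \forall j \near \oo, V (v j) := vcv _ nV.
have x2X : \forall j \near \oo, X (x j + t j *: dx j) := x2cv _ nX.
have v2V : \forall j \near \oo, V (v j + t j *: dv j) := v2cv _ nV.
have [j [Xx [Vv [Xx2 [Vv2 [hdx hdv]]]]]] := filter_ex (filterI xX
  (filterI vV (filterI x2X (filterI v2V (filterI dxs dvs))))).
have := lip _ _ Xx2 Xx.
rewrite -(sE _ _ Xx Vv (Sxv j)) -(sE _ _ Xx2 Vv2 (Syw j)).
rewrite ![_ + _ - _]addrAC !subrr !add0r !normrZ mulrCA.
rewrite ler_pM2l ?normr_gt0 ?gt_eqF //.
apply/negP; rewrite -ltNge (le_lt_trans _ hdv) //.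
move: hdx; rewrite ltr_pdivlMr ?mulr_gt0 // => /ltW hdx.
by rewrite ler_pdivlMr // mulrC mulrA mulrC.
Qed.

(** The estimate at [x = y] makes [S] single-valued near the reference point, so [f] is injective
    near [w0] and invariance of domain provides the neighborhood [X]. *)
Lemma lipschitz_localization (R : realType) (N M : nat)
    (S : 'rV[R]_N -> set 'rV[R]_M) (xbar : 'rV[R]_N) (vbar : 'rV[R]_M)
    (kappa r : R) :
    S xbar vbar -> crypto_continuous S xbar vbar -> 0 < r ->
    (forall x y v w,
      `|xbar - x| < r -> `|xbar - y| < r ->
      `|vbar - v| < r -> `|vbar - w| < r ->
      S x v -> S y w -> `|v - w| <= kappa * `|x - y|) ->
  exists (X : set 'rV[R]_N) (V : set 'rV[R]_M) (s : 'rV[R]_N -> 'rV[R]_M),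
    single_valued_localization S xbar vbar X V s /\ [lipschitz s x | x in X].
Proof.
move=> Sbar [X0 [V0 [nX0 nV0 [W [f [g [h [Wo [fc gc] CE _ hK]]]]]]]] r0 lip.
have [w0 Ww0 [fw0 gw0]] : [set (f w, g w) | w in W] (xbar, vbar).
  by rewrite -CE; split=> //; split; exact: nbhs_singleton.
have {}fc w : W w -> {for w, continuous f}.
  move=> Ww; move: fc; rewrite continuous_open_subspace //.
  by apply; rewrite inE.
have {}gc w : W w -> {for w, continuous g}.
  move=> Ww; move: gc; rewrite continuous_open_subspace //.
  by apply; rewrite inE.
have gphW w : W w -> S (f w) (g w).
  move=> Ww; have [] : ((X0 `*` V0) `&` gph S) (f w, g w); rewrite ?CE //.
  by exists w.
have fnear : nbhs w0 [set w | `|xbar - f w| < r].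
  by have /cvgrPdist_lt := fc _ Ww0; rewrite fw0; apply.
have gnear : nbhs w0 [set w | `|vbar - g w| < r].
  by have /cvgrPdist_lt := gc _ Ww0; rewrite gw0; apply.
have /nbhs_ballP[rho /= rho0 hrho] : nbhs w0 (W `&`
    ([set w | `|xbar - f w| < r] `&` [set w | `|vbar - g w| < r])).
  by apply: filterI; [exact: open_nbhs_nbhs|exact: filterI].
(* The unit cube is rescaled to the closed ball of radius [rho / 2] around [w0], inside the open
   ball given by [hrho]. *)
pose p (b : 'rV[R]_N) := w0 + (rho / 2) *: b.
have rho2 : 0 < rho / 2 by rewrite divr_gt0.
have pB b : `|b| <= 1 -> ball w0 rho (p b).
  move=> b1; rewrite -ball_normE /= opprD addNKr normrN normrZ gtr0_norm //.
  apply: (@le_lt_trans _ _ (rho / 2)); first by rewrite ger_pMr.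
  by rewrite ltr_pdivrMr //; lra.
pose F := f \o p.
have FX : nbhs xbar (F @` [set b | `|b| <= 1]).
  have -> : xbar = F 0 by rewrite /F /= /p scaler0 addr0.
  apply: unit_cube_image_nbhs.
    move=> b b1; apply: continuous_comp.
      apply: (@continuousD _ _ _ (fun=> w0) (fun z => (rho / 2) *: z)).
        exact: cst_continuous.
      exact: scaler_continuous.
    by apply: fc; have [] := hrho _ (pB _ b1).
  (* Equal values of [f] force equal values of [g] by [lip], and [h] then recovers the parameter. *)
  move=> b b' b1 b1'; rewrite /F /= => Fbb'.
  have [Wb [fb gb]] := hrho _ (pB _ b1).
  have [Wb' [fb' gb']] := hrho _ (pB _ b1').
  have : `|g (p b) - g (p b')| <= 0.
    have := lip _ _ _ _ fb fb' gb gb' (gphW _ Wb) (gphW _ Wb').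
    by rewrite Fbb' subrr normr0 mulr0.
  rewrite normr_le0 subr_eq0 => /eqP gbb'.
  have := hK _ Wb; rewrite gbb' Fbb' (hK _ Wb') => /addrI /esym.
  by apply: scalerI; rewrite gt_eqF.
set X := _ @` _ in FX.
have Xr x : X x -> `|xbar - x| < r.
  by move=> [b b1 <-]; have [_ []] := hrho _ (pB _ b1).
pose V := [set v : 'rV[R]_M | `|vbar - v| < r].
have /choice[s hs] : forall x, exists v, X x -> V v /\ S x v.
  move=> x; have [[b b1 <-]|nXx] := pselect (X x); last by exists 0.
  exists (g (p b)) => _; have [Wb [fb gb]] := hrho _ (pB _ b1).
  by split=> //; exact: gphW.
have sE x v : X x -> V v -> S x v -> v = s x.
  move=> Xx Vv Sxv; have [Vs Ss] := hs _ Xx.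
  apply/eqP; rewrite -subr_eq0 -normr_le0.
  have := lip _ _ _ _ (Xr _ Xx) (Xr _ Xx) Vv Vs Sxv Ss.
  by rewrite subrr normr0 mulr0.
exists X, V, s; split; last first.
  apply: (@klipschitzW _ _ _ kappa).
    apply: (@globally_properfilter _ _ (xbar, xbar)).
    by split; exact: nbhs_singleton.
  move=> [x y] /= [Xx Xy]; have [Vs Ss] := hs _ Xx; have [Vs' Ss'] := hs _ Xy.
  exact: lip (Xr _ Xx) (Xr _ Xy) Vs Vs' Ss Ss'.
split=> //.
- by apply/nbhs_ballP; exists r => // v; rewrite -ball_normE.
- by move=> x Xx; have [] := hs _ Xx.
- apply/esym/sE => //; first exact: nbhs_singleton.
  by rewrite /V /= subrr normr0.
- apply/seteqP; split=> [_ [x Xx <-]|[x v] [[/= Xx Vv] Sxv]].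
    by have [] := hs _ Xx.
  by exists x => //; rewrite -(sE _ _ Xx Vv Sxv).
Qed.

Theorem theorem2p3 (R : realType) (N M : nat)
    (S : 'rV[R]_N -> set 'rV[R]_M) (xbar : 'rV[R]_N) (vbar : 'rV[R]_M)
    (S_closed : closed (gph S))
    (vbar_in : S xbar vbar)
    (S_crypto : crypto_continuous S xbar vbar) :
  strict_graphical_derivative S xbar vbar 0 = [set 0] <->
  exists (X : set 'rV[R]_N) (V : set 'rV[R]_M) (s : 'rV[R]_N -> 'rV[R]_M),
    single_valued_localization S xbar vbar X V s /\ [lipschitz s x | x in X].
Proof.
split=> [D0|[X [V [s [sloc slip]]]]].
  have [|kappa [r [r0 lip]]] := @strict_derivative_lipschitz R N M S xbar vbar.
    by move=> v'; rewrite D0.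
  exact: lipschitz_localization lip.
apply/seteqP; split=> [v'|_ ->].
  exact: localization_strict_derivative sloc slip.
(* Zero increments at the constant point [(xbar, vbar)] realize the value 0. *)
exists (fun k => k.+1%:R^-1), (fun=> xbar), (fun=> 0), (fun=> vbar), (fun=> 0).
split=> //; try by split; exact: cvg_cst.
  split=> [k|]; first by rewrite invr_gt0.
  apply: (@cvg_dist_natSinv _ _ _ _ 1) => k.
  by rewrite sub0r normrN mul1r ger0_norm ?invr_ge0.
by move=> k; rewrite !scaler0 !addr0.
Qed.
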